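(* Let $p_1',p_2',p_3',p_4'\in\mathbb{R}^3$ be the unit vectors, in the coordinates $(\lambda_{12},\lambda_{13},\lambda_{23})$, $$p_1'=\tfrac{1}{\rho_1}(1,\,2+2\sqrt2,\,1),\quad p_2'=\tfrac{1}{\sqrt3}(1,1,1),\quad p_3'=\rho_3\big(\tfrac{-1+\sqrt2}{2},\tfrac{-1+\sqrt2}{2},1\big),\quad p_4'=\tfrac{1}{\rho_1}(2+2\sqrt2,\,1,\,1),$$ where $\rho_1=\sqrt{2+(2+2\sqrt2)^2}$ and $1/\rho_3=\sqrt{1+2\big(\tfrac{-1+\sqrt2}{2}\big)^2}$. For $j=1,2,3,4$ let $\gamma_j(t)=t\,p_j'$, and regard $\gamma_j$ as the open ray $\{s\,p_j' : s>0\}$ in $\mathbb{R}^3$. Then each of the lines $\gamma_1,\gamma_2,\gamma_3,\gamma_4$ is (up to parametrization) a solution curve of the system $$\dot\lambda_{12}=6\lambda_{13}\lambda_{23}+\lambda_{12}^2-\lambda_{13}^2-\lambda_{23}^2,$$ $$\dot\lambda_{13}=6\lambda_{12}\lambda_{23}+\lambda_{13}^2-\lambda_{12}^2-\lambda_{23}^2,$$ $$\dot\lambda_{23}=6\lambda_{12}\lambda_{13}+\lambda_{23}^2-\lambda_{13}^2-\lambda_{12}^2,$$ and also of the system $\dot\lambda_{ij}=-2r_{ij}$, $1\le i<j\le3$ (with $r_{ij}$ as given in the context), and $\gamma_j$ passes through the point $p_j''\in\mathbb{R}^3$ having the same coordinates as $p_j'$.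
   Context: The functions $r_{ij}$, defined for nonzero $\lambda_{12},\lambda_{13},\lambda_{23}$, are $$r_{12}=\frac{1}{2\lambda_{12}}+\frac1{12}\Big(\frac{\lambda_{12}}{\lambda_{13}\lambda_{23}}-\frac{\lambda_{13}}{\lambda_{12}\lambda_{23}}-\frac{\lambda_{23}}{\lambda_{12}\lambda_{13}}\Big),$$ $$r_{13}=\frac{1}{2\lambda_{13}}+\frac1{12}\Big(\frac{\lambda_{13}}{\lambda_{12}\lambda_{23}}-\frac{\lambda_{12}}{\lambda_{13}\lambda_{23}}-\frac{\lambda_{23}}{\lambda_{12}\lambda_{13}}\Big),$$ $$r_{23}=\frac{1}{2\lambda_{23}}+\frac1{12}\Big(\frac{\lambda_{23}}{\lambda_{12}\lambda_{13}}-\frac{\lambda_{13}}{\lambda_{23}\lambda_{12}}-\frac{\lambda_{12}}{\lambda_{23}\lambda_{13}}\Big).$$ The curve $\gamma_j:[0,1]\to\mathbb{R}^3$, $\gamma_j(t)=t\,p_j'$, originally lies in the closed unit ball, into which $\mathbb{R}^3$ is mapped by $\pi(x)=x/\sqrt{1+\|x\|^2}$ (the unit sphere representing infinity); the corresponding curve $\pi^{-1}\circ\gamma_j:(0,1)\to\mathbb{R}^3$ has image the open ray $\{s\,p_j':s>0\}$. A curve is a solution curve up to parametrization if it is the image of a solution of the system. *)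

(* Defs.v *)
From mathcomp Require Import all_boot all_order all_algebra.
From mathcomp Require Import all_classical all_reals all_analysis.
From mathcomp Require Import ring lra.

Set Implicit Arguments.
Unset Strict Implicit.
Unset Printing Implicit Defensive.

Import Order.TTheory GRing.Theory Num.Theory.
Import numFieldNormedType.Exports.

Local Open Scope classical_set_scope.
Local Open Scope ring_scope.

Definition vec3 (R : realType) (a b c : R) : 'rV[R]_3 :=
  \row_(i < 3) [:: a; b; c]`_i.

(* Coordinates on R^3, in the order (lambda_12, lambda_13, lambda_23). *)
Definition l12 (R : realType) (v : 'rV[R]_3) : R := v 0 0.
Definition l13 (R : realType) (v : 'rV[R]_3) : R := v 0 1.
Definition l23 (R : realType) (v : 'rV[R]_3) : R := v 0 2.

(* The library norm on 'rV[R]_3 is the sup norm, hence this definition. *)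
Definition enorm (R : realType) (v : 'rV[R]_3) : R :=
  Num.sqrt (\sum_(i < 3) v 0 i ^+ 2).

Section Points.
Variable R : realType.

Definition rho1 : R := Num.sqrt (2 + (2 + 2 * Num.sqrt 2) ^+ 2).

(* The defining formula gives 1 / rho3. *)
Definition rho3 : R :=
  (Num.sqrt (1 + 2 * ((- 1 + Num.sqrt 2) / 2) ^+ 2))^-1.

Definition p1 : 'rV[R]_3 := rho1^-1 *: vec3 1 (2 + 2 * Num.sqrt 2) 1.
Definition p2 : 'rV[R]_3 := (Num.sqrt 3)^-1 *: vec3 1 1 1.
Definition p3 : 'rV[R]_3 :=
  rho3 *: vec3 ((- 1 + Num.sqrt 2) / 2) ((- 1 + Num.sqrt 2) / 2) 1.
Definition p4 : 'rV[R]_3 := rho1^-1 *: vec3 (2 + 2 * Num.sqrt 2) 1 1.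

(* Indices are shifted: the ordinal j stands for the point p'_(j+1). *)
Definition p' (j : 'I_4) : 'rV[R]_3 := [:: p1; p2; p3; p4]`_j.

(* p' j is a point at infinity on the unit sphere bounding the compactified
   ball; p'' j is the point of R^3 itself with the same coordinates. *)
Definition p'' (j : 'I_4) : 'rV[R]_3 := p' j.

End Points.

(* pi : R^3 -> open unit ball *)
Definition ballmap (R : realType) (x : 'rV[R]_3) : 'rV[R]_3 :=
  (Num.sqrt (1 + enorm x ^+ 2))^-1 *: x.

Definition gamma (R : realType) (j : 'I_4) (t : R) : 'rV[R]_3 := t *: p' R j.

(* The curve gamma j regarded in R^3; gamma_rayE below shows that this is the
   image of pi^-1 o gamma j on (0, 1). *)
Definition gamma_ray (R : realType) (j : 'I_4) : set 'rV[R]_3 :=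
  [set s *: p' R j | s in [set s : R | 0 < s]].
Arguments gamma_ray R j : clear implicits.

Section Systems.
Variable R : realType.
Implicit Types (v : 'rV[R]_3).

Definition poly_field v : 'rV[R]_3 :=
  vec3 (6 * l13 v * l23 v + l12 v ^+ 2 - l13 v ^+ 2 - l23 v ^+ 2)
       (6 * l12 v * l23 v + l13 v ^+ 2 - l12 v ^+ 2 - l23 v ^+ 2)
       (6 * l12 v * l13 v + l23 v ^+ 2 - l13 v ^+ 2 - l12 v ^+ 2).

Definition r12 v : R :=
  1 / (2 * l12 v) + 1 / 12 * (l12 v / (l13 v * l23 v)
    - l13 v / (l12 v * l23 v) - l23 v / (l12 v * l13 v)).
Definition r13 v : R :=
  1 / (2 * l13 v) + 1 / 12 * (l13 v / (l12 v * l23 v)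
    - l12 v / (l13 v * l23 v) - l23 v / (l12 v * l13 v)).
Definition r23 v : R :=
  1 / (2 * l23 v) + 1 / 12 * (l23 v / (l12 v * l13 v)
    - l13 v / (l23 v * l12 v) - l12 v / (l23 v * l13 v)).

Definition ricci_field v : 'rV[R]_3 :=
  vec3 (- 2 * r12 v) (- 2 * r13 v) (- 2 * r23 v).

Definition ricci_domain : set 'rV[R]_3 :=
  [set v | [/\ l12 v != 0, l13 v != 0 & l23 v != 0]].

(* lambda solves lambda' = F(lambda) on the interval J, staying in the domain
   D of F. Since lambda is a total function, only its values on J matter. *)
Definition is_solution (D : set 'rV[R]_3) (F : 'rV[R]_3 -> 'rV[R]_3)
    (J : set R) (lambda : R -> 'rV[R]_3) : Prop :=
  forall t, J t -> D (lambda t) /\ is_derive t (1 : R) lambda (F (lambda t)).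

Definition solution_curve (D : set 'rV[R]_3) (F : 'rV[R]_3 -> 'rV[R]_3)
    (C : set 'rV[R]_3) : Prop :=
  exists (J : set R) (lambda : R -> 'rV[R]_3),
    [/\ open J, is_interval J, is_solution D F J lambda & lambda @` J = C].

End Systems.

Lemma enormZ (R : realType) (s : R) (v : 'rV[R]_3) :
  0 <= s -> enorm (s *: v) = s * enorm v.
Proof.
move=> s0; rewrite /enorm.
under eq_bigr do rewrite mxE exprMn.
by rewrite -mulr_sumr sqrtrM ?sqr_ge0 // sqrtr_sqr ger0_norm.
Qed.

Lemma enorm_vec3 (R : realType) (a b c : R) :
  enorm (vec3 a b c) = Num.sqrt (a ^+ 2 + b ^+ 2 + c ^+ 2).
Proof. by rewrite /enorm !big_ord_recr big_ord0 /= !mxE /= add0r. Qed.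

Lemma enorm_p' (R : realType) (j : 'I_4) : enorm (p' R j) = 1.
Proof.
have key (x y : R) : 0 < x -> x = y -> (Num.sqrt x)^-1 * Num.sqrt y = 1.
  by move=> x0 <-; rewrite mulVf // gt_eqF // sqrtr_gt0.
have pos2 (x : R) : 0 < 2 + x ^+ 2 by have := sqr_ge0 x; lra.
have pos1 (x : R) : 0 < 1 + 2 * x ^+ 2 by have := sqr_ge0 x; lra.
case: j => -[|[|[|[|//]]]] jlt;
  rewrite /p' /= enormZ ?invr_ge0 ?sqrtr_ge0 // enorm_vec3; apply: key => //;
  by [lra | ring].
Qed.

Lemma gamma_rayE (R : realType) (j : 'I_4) :
  [set x | exists2 t : R, 0 < t < 1 & ballmap x = gamma j t] = gamma_ray R j.
Proof.
apply/seteqP; split => [x [t /andP[t0 _]]|_ [s /= s0 <-]].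
  rewrite /ballmap /gamma => e.
  have q0 : 0 < Num.sqrt (1 + enorm x ^+ 2).
    by rewrite sqrtr_gt0; have := sqr_ge0 (enorm x); lra.
  exists (Num.sqrt (1 + enorm x ^+ 2) * t); first exact: mulr_gt0.
  by rewrite -scalerA -e scalerA mulfV ?scale1r // gt_eqF.
have q0 : 0 < Num.sqrt (1 + s ^+ 2).
  by rewrite sqrtr_gt0; have := sqr_ge0 s; lra.
exists ((Num.sqrt (1 + s ^+ 2))^-1 * s).
  rewrite mulr_gt0 ?invr_gt0 //= mulrC ltr_pdivrMr // mul1r.
  rewrite -{1}[s]ger0_norm ?ltW // -sqrtr_sqr ltr_sqrt; last first.
    by have := sqr_ge0 s; lra.
  by lra.
by rewrite /ballmap /gamma enormZ ?ltW // enorm_p' mulr1 scalerA.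
Qed.

(* Main.v *)
(** Each ray is spanned by a positive eigenvector [v] of the homogeneous quadratic
    field [F], [F v = k *: v] with [k > 0].  Along [s *: v] the polynomial system
    becomes [s' = k s^2], solved by [s = - 1 / (k t)]; the field of the second
    system is [- F / (6 l12 l13 l23)], of degree [-1], so that one becomes
    [s' = - c / s], solved by [s = Num.sqrt (- 2 c t)].  Both solutions sweep the
    whole ray for [t < 0]. *)

Require Import Defs.
From mathcomp Require Import all_boot all_order all_algebra.
From mathcomp Require Import all_classical all_reals all_analysis.
From mathcomp Require Import ring lra.

Set Implicit Arguments.
Unset Strict Implicit.
Unset Printing Implicit Defensive.

Import Order.TTheory GRing.Theory Num.Theory.
Import numFieldNormedType.Exports.

Local Open Scope classical_set_scope.
Local Open Scope ring_scope.

Lemma is_deriveZl (R : realType) (V : normedModType R) (phi : R -> R) (v : V)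
    (t d : R) :
  is_derive t 1 phi d -> is_derive t 1 (fun s => phi s *: v) (d *: v).
Proof.
move=> [/derivable1_diffP dphi phiE].
have dphiv := differentiableZl v dphi.
apply: DeriveDef; first exact: diff_derivable.
by rewrite deriveE // diffZl // -deriveE // phiE.
Qed.

Lemma scale_vec3 (R : realType) (s a b c : R) :
  s *: vec3 a b c = vec3 (s * a) (s * b) (s * c).
Proof.
by apply/rowP => -[[|[|[|//]]] i3]; rewrite !mxE.
Qed.

Lemma l12_vec3 (R : realType) (a b c : R) : l12 (vec3 a b c) = a.
Proof. by rewrite /l12 mxE. Qed.

Lemma l13_vec3 (R : realType) (a b c : R) : l13 (vec3 a b c) = b.
Proof. by rewrite /l13 mxE. Qed.

Lemma l23_vec3 (R : realType) (a b c : R) : l23 (vec3 a b c) = c.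
Proof. by rewrite /l23 mxE. Qed.

Definition vec3E := (l12_vec3, l13_vec3, l23_vec3).

Lemma l12Z (R : realType) (s : R) v : l12 (s *: v) = s * l12 v.
Proof. by rewrite /l12 mxE. Qed.

Lemma l13Z (R : realType) (s : R) v : l13 (s *: v) = s * l13 v.
Proof. by rewrite /l13 mxE. Qed.

Lemma l23Z (R : realType) (s : R) v : l23 (s *: v) = s * l23 v.
Proof. by rewrite /l23 mxE. Qed.

Definition coordZ := (l12Z, l13Z, l23Z).

Lemma poly_fieldZ (R : realType) (s : R) (v : 'rV[R]_3) :
  poly_field (s *: v) = s ^+ 2 *: poly_field v.
Proof.
by rewrite /poly_field !coordZ scale_vec3; congr vec3; ring.
Qed.

(** Over the common denominator [12 * l12 v * l13 v * l23 v], the numerators of the three [r_ij] are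
    exactly the coordinates of [poly_field v]; the factor -2 turns 12 into -6. *)
Lemma ricci_fieldE (R : realType) (v : 'rV[R]_3) : ricci_domain v ->
  ricci_field v = - (6 * l12 v * l13 v * l23 v)^-1 *: poly_field v.
Proof.
move=> [v12 v13 v23]; rewrite /ricci_field /poly_field scale_vec3.
by congr vec3; rewrite /r12 /r13 /r23; field; rewrite v12 v13 v23.
Qed.

(** A field tangent to the ray reduces there to the scalar equation s' = g(s). The last hypothesis
    makes the solution sweep the whole ray and not just a segment of it. *)
Lemma ray_solution_curve (R : realType) (D : set 'rV[R]_3) F (v : 'rV[R]_3)
    (g phi : R -> R) :
  (forall s, 0 < s -> D (s *: v) /\ F (s *: v) = g s *: v) ->
  (forall t, t < 0 -> 0 < phi t /\ is_derive t (1 : R) phi (g (phi t))) ->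
  (forall s, 0 < s -> exists2 t, t < 0 & phi t = s) ->
  solution_curve D F [set s *: v | s in [set s : R | 0 < s]].
Proof.
move=> Fv phi_sol phi_onto.
exists [set` `]-oo, 0[], (fun t => phi t *: v); split.
- exact: interval_open.
- exact: interval_is_interval.
- move=> t /=; rewrite in_itv /= => t0.
  have [phi0 dphi] := phi_sol _ t0; have [Dv ->] := Fv _ phi0.
  by split=> //; exact: is_deriveZl.
- apply/seteqP; split=> [_ [t /= + <-]|_ [s /= s0 <-]].
    by rewrite in_itv /= => t0; exists (phi t) => //; have [] := phi_sol _ t0.
  have [t t0 <-] := phi_onto _ s0.
  by exists t => //=; rewrite in_itv.
Qed.

Lemma poly_ray_solution (R : realType) (v : 'rV[R]_3) (k : R) :
  0 < k -> poly_field v = k *: v ->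
  solution_curve setT (@poly_field R) [set s *: v | s in [set s : R | 0 < s]].
Proof.
move=> k0 Fv.
(* This solution runs outward: it leaves the origin at time minus infinity and blows up as t tends
   to 0. *)
apply: (@ray_solution_curve _ _ _ _ (fun s => s ^+ 2 * k)
  (fun t => (- k * t)^-1)) => [s _|t t0|s s0].
- by split=> //; rewrite poly_fieldZ Fv scalerA.
- have kt0 : 0 < - k * t by rewrite nmulr_rgt0 // oppr_lt0.
  split; first by rewrite invr_gt0.
  have dkt : is_derive t 1 (fun t => - k * t) (- k).
    by apply: (@is_derive_eq _ _ _ (- k *: id)); rewrite /GRing.scale /= mulr1.
  apply: is_derive_eq; first by apply: is_deriveV dkt; rewrite gt_eqF.
  by rewrite /GRing.scale /= exprVn mulrNN.
- exists (- (k * s)^-1); first by rewrite oppr_lt0 invr_gt0 mulr_gt0.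
  by field; rewrite !gt_eqF.
Qed.

Lemma ricci_ray_solution (R : realType) (v : 'rV[R]_3) (k : R) :
  0 < k -> poly_field v = k *: v ->
  0 < l12 v -> 0 < l13 v -> 0 < l23 v ->
  solution_curve (@ricci_domain R) (@ricci_field R)
    [set s *: v | s in [set s : R | 0 < s]].
Proof.
move=> k0 Fv v12 v13 v23.
(* At [s *: v] the prefactor contributes s^-3 and [poly_field] s^2, so the field there is -(c / s)
   times [v]. *)
pose c := k / (6 * l12 v * l13 v * l23 v).
have c0 : 0 < c by rewrite divr_gt0 // !mulr_gt0.
(* The equation s' = -c / s says (s^2)' = -2c. The ray is now run inward, tending as t tends to 0 to
   the origin, which lies outside [ricci_domain]. *)
apply: (@ray_solution_curve _ _ _ _ (fun s => - c / s)
  (fun t => Num.sqrt (- (2 * c) * t))) => [s s0|t t0|s s0].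
- have Dsv : ricci_domain (s *: v).
    by rewrite /ricci_domain /= !coordZ; split; rewrite gt_eqF ?mulr_gt0.
  split=> //; rewrite ricci_fieldE // poly_fieldZ Fv !scalerA !coordZ.
  by congr (_ *: _); rewrite /c; field; rewrite !gt_eqF.
- have ct0 : 0 < - (2 * c) * t by rewrite nmulr_rgt0 // oppr_lt0 mulr_gt0.
  split; first by rewrite sqrtr_gt0.
  have dct : is_derive t 1 (fun t => - (2 * c) * t) (- (2 * c)).
    by apply: (@is_derive_eq _ _ _ (- (2 * c) *: id));
      rewrite /GRing.scale /= mulr1.
  have dsqrt := is_derive1_sqrt ct0.
  apply: (is_derive_eq (is_derive1_comp dsqrt dct)).
  by field; rewrite gt_eqF ?sqrtr_gt0.
- exists (- (s ^+ 2 / (2 * c))).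
    by rewrite oppr_lt0; apply: divr_gt0; [exact: exprn_gt0|exact: mulr_gt0].
  have -> : - (2 * c) * - (s ^+ 2 / (2 * c)) = s ^+ 2 by field; rewrite gt_eqF.
  by rewrite sqrtr_sqr ger0_norm // ltW.
Qed.

Lemma p'_eigenvector (R : realType) (j : 'I_4) :
  exists k, [/\ 0 < k, poly_field (p' R j) = k *: p' R j,
    0 < l12 (p' R j), 0 < l13 (p' R j) & 0 < l23 (p' R j)].
Proof.
suff [rho [a [b [c [k [rho0 k0 [a0 b0 c0] Fu ->]]]]]] : exists rho a b c k : R,
    [/\ 0 < rho, 0 < k, [/\ 0 < a, 0 < b & 0 < c],
      poly_field (vec3 a b c) = k *: vec3 a b c & p' R j = rho *: vec3 a b c].
  exists (rho * k); rewrite !coordZ !vec3E; split; rewrite ?mulr_gt0 //.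
  by rewrite poly_fieldZ Fu !scalerA; congr (_ *: _); ring.
set r : R := Num.sqrt 2.
have r2 : r ^+ 2 = 2 by rewrite sqr_sqrtr.
have r1 : 1 < r by rewrite -(sqrtr1 R) ltr_sqrt //; lra.
have rho1_gt0 : 0 < (rho1 R)^-1.
  by rewrite invr_gt0 sqrtr_gt0; have := sqr_ge0 (2 + 2 * Num.sqrt 2 : R); lra.
have rho3_gt0 : 0 < rho3 R.
  by rewrite invr_gt0 sqrtr_gt0; have := sqr_ge0 ((- 1 + Num.sqrt 2) / 2 : R); lra.
case: j => -[|[|[|[|//]]]] j4; rewrite /p' /=.
(* For (1, b, 1) the first coordinate forces k = b(6 - b); the second then gives (b - 1)(b^2 - 4b -
   4) = 0, whose positive roots are 1 and 2 + 2r. *)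
- exists (rho1 R)^-1, 1, (2 + 2 * r), 1, (4 * r); split=> //; first by lra.
    by split=> //; lra.
  by rewrite /poly_field !vec3E scale_vec3; congr vec3; ring: r2.
- exists (Num.sqrt 3)^-1, 1, 1, 1, 5; split=> //.
  by rewrite /poly_field !vec3E scale_vec3; congr vec3; ring.
(* Since (r - 1) / 2 is the inverse of 2 + 2r, this vector is (1, 1, 2 + 2r) rescaled, a permutation
   of the previous case; its eigenvalue is 4r(r - 1) / 2 = 4 - 2r, positive because r^2 = 2 gives r
   < 2. *)
- exists (rho3 R), ((- 1 + r) / 2), ((- 1 + r) / 2), 1, (4 - 2 * r).
  split=> //; first by nra.
    by split=> //; lra.
  by rewrite /poly_field !vec3E scale_vec3; congr vec3; field: r2.
- exists (rho1 R)^-1, (2 + 2 * r), 1, 1, (4 * r); split=> //; first by lra.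
    by split=> //; lra.
  by rewrite /poly_field !vec3E scale_vec3; congr vec3; ring: r2.
Qed.

Theorem theorem2 (R : realType) (j : 'I_4) :
  [/\ solution_curve setT (@poly_field R) (gamma_ray R j),
      solution_curve (@ricci_domain R) (@ricci_field R) (gamma_ray R j)
    & gamma_ray R j (p'' R j)].
Proof.
have [k [k0 Fp p12 p13 p23]] := p'_eigenvector R j.
split; first exact: poly_ray_solution k0 Fp.
- exact: ricci_ray_solution k0 Fp p12 p13 p23.
- by exists 1; rewrite /= ?scale1r.
Qed.
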